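(* Let $\Delta=(N_1,\dots,N_l)$ be a partition of $n$ with $N_1\le\dots\le N_l\le p$ and $z\in M(d,n;\mathbb{F}_q)$. (i) For $g\in GL_d(\mathbb{F}_q)$, the map $L_g\colon X_{\Delta,z}\to X_{\Delta,gz}$, $((t_i,u_i),s)\mapsto((t_i,u_i),sg^{-1})$, is an isomorphism. (ii) For $h=\mathrm{diag}(h_1,\dots,h_l)\in H_\Delta$ with $h_i=[h_{(i,0)},\dots,h_{(i,N_i-1)}]\in J(N_i)$, the map $R_h\colon X_{\Delta,z}\otimes\mathbb{k}'\to X_{\Delta,zh}\otimes\mathbb{k}'$, $((t_i,u_i),s)\mapsto((t'_i,u'_i),s)$ with $t'_i=\sqrt[N]{h_{(i,0)}}\,t_i$ and $u'_{(i,j)}=u_{(i,j)}+r(\theta_j(h_i))$, is an isomorphism, where $\mathbb{k}'=\mathbb{F}_{q^N}$ if $\Delta=(1,\dots,1)$ and $\mathbb{k}'=\mathbb{F}_{q^{pN}}$ otherwise.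
   Context: $q$ is a power of a prime $p$, $N=q-1$. For $m\ge1$ let $\Lambda$ be the $m\times m$ matrix with $1$'s on the superdiagonal, $[h_0,\dots,h_{m-1}]=\sum_i h_i\Lambda^i$, $J(m)=\{[h_0,\dots,h_{m-1}]:h_0\in\mathbb{F}_q^*,h_i\in\mathbb{F}_q\}$. For $x=(x_0,x_1,\dots)$, $X_j=x_j/x_0$, $\theta_i(x)=\sum_{k_1+2k_2+\dots+ik_i=i,\,k_j\ge0}(-1)^{k_1+\dots+k_i-1}\frac{(k_1+\dots+k_i-1)!}{k_1!\cdots k_i!}X_1^{k_1}\cdots X_i^{k_i}$, $\overline\theta_i(x)=x_0^i\theta_i(x)$, $\theta_i([h_0,\dots,h_{m-1}])=\theta_i(h_0,\dots,h_i)$. $H_\Delta=\{\mathrm{diag}(h_1,\dots,h_l):h_i\in J(N_i)\}$. Write $z=(z^{(1)},\dots,z^{(l)})$, $z^{(i)}=(z^{(i)}_0,\dots,z^{(i)}_{N_i-1})$ consecutive column blocks; for a row vector $s\in\mathbb{F}_q^d$, $sz^{(i)}$ denotes $(sz^{(i)}_0,\dots,sz^{(i)}_{N_i-1})$. $X_{\Delta,z}$ is the affine variety over $\mathbb{F}_q$ in coordinates $t_i$ ($1\le i\le l$), $u_i=(u_{(i,1)},\dots,u_{(i,N_i-1)})$, $s=(s_1,\dots,s_d)$, defined by $t_i^N=sz^{(i)}_0$, $t_i^{Nj}(u_{(i,j)}^q-u_{(i,j)})=\overline\theta_j(sz^{(i)})$ ($1\le j\le N_i-1$), $t_i\ne0$.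 For each $a\in\mathbb{F}_q^*$ a fixed $N$-th root $\sqrt[N]{a}\in\mathbb{F}_{q^N}$ is chosen (with $\sqrt[N]{1}=1$); $r(1)$ is a fixed root of $x^q-x=1$ in $\mathbb{F}_{q^p}$ and $r(t)=t\cdot r(1)$ for $t\in\mathbb{F}_q$. For a variety $X$ over $\mathbb{F}_q$ and an extension $\mathbb{k}'/\mathbb{F}_q$, $X\otimes\mathbb{k}'=X\times_{\mathrm{Spec}\,\mathbb{F}_q}\mathrm{Spec}\,\mathbb{k}'$. *)

(* Defs.v *)
From HB Require Import structures.
From mathcomp Require Import all_boot all_order all_algebra.

Set Implicit Arguments.
Unset Strict Implicit.
Unset Printing Implicit Defensive.

Import GRing.Theory.
Local Open Scope ring_scope.

Record kalgebra (k : fieldType) := KAlgebra {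
  kalg_ring :> comUnitRingType;
  kalg_str : {rmorphism k -> kalg_ring}
}.

Record khom (k : fieldType) (A B : kalgebra k) := KHom {
  khom_fun :> {rmorphism A -> B};
  khomP : forall c, khom_fun (kalg_str A c) = kalg_str B c
}.

(* A subscheme X of the affine space with coordinates indexed by V is given by
   its sets X(A) of A-points, a subset of A^V for every commutative k-algebra
   A, functorially in A. *)
Record kscheme (k : fieldType) (V : Type) := KScheme {
  kpt :> forall A : kalgebra k, (V -> A) -> Prop;
  kptP : forall (A B : kalgebra k) (f : khom A B) (x : V -> A),
    kpt x -> kpt (fun v => f (x v))
}.

Section Morphisms.
Variables (k : fieldType) (V W : Type).

Definition kmap (V1 V2 : Type) := forall A : kalgebra k, (V1 -> A) -> (V2 -> A).

(* A morphism X -> Y is a family of maps X(A) -> Y(A) that is natural in A;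
   the values of phi outside X are irrelevant. *)
Definition is_morphism (V1 V2 : Type) (X : kscheme k V1) (Y : kscheme k V2)
    (phi : kmap V1 V2) : Prop :=
  (forall (A : kalgebra k) (x : V1 -> A), X A x -> Y A (phi A x)) /\
  (forall (A B : kalgebra k) (f : khom A B) (x : V1 -> A), X A x ->
     phi B (fun v => f (x v)) =1 (fun w => f (phi A x w))).

Definition is_isomorphism (X : kscheme k V) (Y : kscheme k W)
    (phi : kmap V W) : Prop :=
  is_morphism X Y phi /\
  exists psi : kmap W V,
    [/\ is_morphism Y X psi,
        forall (A : kalgebra k) (x : V -> A), X A x -> psi A (phi A x) =1 x
      & forall (A : kalgebra k) (y : W -> A), Y A y -> phi A (psi A y) =1 y].

End Morphisms.

Section BaseChange.
Variables (k K : fieldType) (iota : {rmorphism k -> K}).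

Definition restrict (A : kalgebra K) : kalgebra k :=
  @KAlgebra k A (kalg_str A \o iota).

Lemma restrict_homP (A B : kalgebra K) (f : khom A B) (c : k) :
  f (kalg_str (restrict A) c) = kalg_str (restrict B) c.
Proof. exact: khomP. Qed.

Definition restrict_hom (A B : kalgebra K) (f : khom A B) :
  khom (restrict A) (restrict B) :=
  @KHom k (restrict A) (restrict B) f (restrict_homP f).

(* The fibre product of X and Spec K over Spec k: its points in a K-algebra
   are the points of X in the underlying k-algebra. *)
Definition base_change (V : Type) (X : kscheme k V) : kscheme K V :=
  @KScheme K V (fun A x => X (restrict A) x)
    (fun A B f x => @kptP k V X _ _ (restrict_hom f) x).

End BaseChange.

(* The tuples (k_1, .., k_i) with k_1 + 2 k_2 + .. + i k_i = i are the
   functions k with k_(j+1) = k j; the constraint forces k_j <= i.  The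
   rational coefficients are read in F: for i < p, with p the characteristic,
   their denominators are invertible there.  Meaningful for i >= 1 and x 0
   invertible. *)
Definition theta (F : fieldType) (A : comUnitRingType)
    (str : {rmorphism F -> A}) (i : nat) (x : nat -> A) : A :=
  \sum_(k : {ffun 'I_i -> 'I_i.+1} | (\sum_(j < i) j.+1 * k j == i)%N)
     str ((-1) ^+ (\sum_(j < i) k j).-1
          * ((\sum_(j < i) k j).-1)`!%:R / (\prod_(j < i) (k j)`!)%:R)
     * \prod_(j < i) (x j.+1 / x 0%N) ^+ k j.

Definition thetabar (F : fieldType) (A : comUnitRingType)
    (str : {rmorphism F -> A}) (i : nat) (x : nat -> A) : A :=
  x 0%N ^+ i * theta str i x.

Lemma thetabar_rmorph (F : fieldType) (A B : comUnitRingType)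
    (sA : {rmorphism F -> A}) (sB : {rmorphism F -> B})
    (f : {rmorphism A -> B}) (i : nat) (x : nat -> A) (y : nat -> B) :
  (forall c, f (sA c) = sB c) -> x 0%N \is a GRing.unit ->
  (forall k, y k = f (x k)) ->
  thetabar sB i y = f (thetabar sA i x).
Proof.
move=> fs x0 yE; rewrite /thetabar /theta yE rmorphM rmorphXn rmorph_sum.
congr (_ * _); apply: eq_bigr => k _; rewrite [RHS]rmorphM fs.
congr (_ * _); rewrite (rmorph_prod f); apply: eq_bigr => j _.
by rewrite yE rmorphXn rmorphM rmorphV.
Qed.

(* The entries of a row vector as a sequence, extended by 0. *)
Definition rseq (A : nmodType) (m : nat) (v : 'rV[A]_m) (k : nat) : A :=
  oapp (fun i : 'I_m => v 0 i) 0 (insub k).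

Lemma rseq_map (A B : nmodType) (f : A -> B) m (v : 'rV[A]_m) k :
  f 0 = 0 -> rseq (map_mx f v) k = f (rseq v k).
Proof. by rewrite /rseq => f0; case: insub => //= i; rewrite mxE. Qed.

Definition shift_mx (F : fieldType) (m : nat) : 'M[F]_m :=
  \matrix_(i, j) (j == i.+1 :> nat)%:R.

Definition bracket (F : fieldType) (m : nat) (c : 'rV[F]_m) : 'M[F]_m :=
  \sum_(i < m) c 0 i *: shift_mx F m ^+ i.

Definition Jgroup (F : fieldType) (m : nat) (A : 'M[F]_m) : Prop :=
  exists2 c : 'rV[F]_m, rseq c 0 != 0 & A = bracket c.

(* Ct i is t_i, Cu i j is u_(i, j+1), Cs a is s_a. *)
Inductive coord (l : nat) (Delta : 'I_l -> nat) (d : nat) :=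
  | Ct of 'I_l
  | Cu (i : 'I_l) of 'I_(Delta i).-1
  | Cs of 'I_d.
Arguments Ct {l Delta d} i.
Arguments Cu {l Delta d} i j.
Arguments Cs {l Delta d} a.

Section Variety.
Variables (F : finFieldType) (l : nat) (Delta : 'I_l -> nat) (d : nat).

Definition srow (A : comUnitRingType) (x : coord Delta d -> A) : 'rV[A]_d :=
  \row_a x (Cs a).

(* The sequence s z^(i). *)
Definition sz (A : kalgebra F) (z : 'M[F]_(d, \sum_i Delta i))
    (x : coord Delta d -> A) (i : 'I_l) : nat -> A :=
  rseq (srow x *m map_mx (kalg_str A) (submxrow z i)).

Definition Xpt (z : 'M[F]_(d, \sum_i Delta i)) (A : kalgebra F)
    (x : coord Delta d -> A) : Prop :=
  forall i : 'I_l,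
    [/\ x (Ct i) \is a GRing.unit,
        x (Ct i) ^+ (#|F|.-1) = sz z x i 0
      & forall j : 'I_(Delta i).-1,
          x (Ct i) ^+ (#|F|.-1 * j.+1) * (x (Cu i j) ^+ #|F| - x (Cu i j))
          = thetabar (kalg_str A) j.+1 (sz z x i)].

Lemma sz_hom (A B : kalgebra F) (f : khom A B) z (x : coord Delta d -> A) i k :
  sz z (fun v => f (x v)) i k = f (sz z x i k).
Proof.
rewrite /sz -rseq_map ?rmorph0 // map_mxM; congr (rseq (_ *m _) k).
  by apply/rowP => a; rewrite !mxE.
by apply/matrixP => a b; rewrite !mxE /= khomP.
Qed.

Lemma XptP z (A B : kalgebra F) (f : khom A B) (x : coord Delta d -> A) :
  Xpt z x -> Xpt z (fun v => f (x v)).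
Proof.
move=> Xx i; have [tU t0 tu] := Xx i; split; first exact: rmorph_unit.
  by rewrite sz_hom -t0 rmorphXn.
move=> j; rewrite (thetabar_rmorph _ (khomP f) _ (sz_hom f z x i)).
  by rewrite -tu rmorphM rmorphB !rmorphXn.
by rewrite -t0 unitrX.
Qed.

Definition Xvar (z : 'M[F]_(d, \sum_i Delta i)) : kscheme F (coord Delta d) :=
  @KScheme F (coord Delta d) (@Xpt z) (@XptP z).

Definition Lmap (g : 'M[F]_d) : kmap F (coord Delta d) (coord Delta d) :=
  fun A x v => match v with
  | Ct i => x (Ct i)
  | Cu i j => x (Cu i j)
  | Cs a => (srow x *m map_mx (kalg_str A) (invmx g)) 0 a
  end.

Section RightAction.
Variables (K : fieldType) (iota : {rmorphism F -> K}).

(* root a is the chosen N-th root of a, r1 stands for r(1), and c i is the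
   sequence of coefficients of h_i. *)
Definition Rmap (root : F -> K) (r1 : K) (c : forall i, 'rV[F]_(Delta i)) :
    kmap K (coord Delta d) (coord Delta d) :=
  fun A x v => match v with
  | Ct i => kalg_str A (root (rseq (c i) 0)) * x (Ct i)
  | Cu i j => x (Cu i j)
              + kalg_str A (iota (theta idfun j.+1 (rseq (c i))) * r1)
  | Cs a => x (Cs a)
  end.

(* A choice of N-th roots in F_(q^N), which is the subfield of K fixed by the
   q^N-power map. *)
Definition Nth_root_choice (root : F -> K) : Prop :=
  root 1 = 1 /\
  forall a : F, a != 0 ->
    root a ^+ (#|F|.-1) = iota a /\ root a ^+ (#|F| ^ #|F|.-1) = root a.

(* A root of x^q - x = 1 in F_(q^p). *)
Definition AS_root (p : nat) (r1 : K) : Prop :=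
  r1 ^+ #|F| - r1 = 1 /\ r1 ^+ (#|F| ^ p) = r1.

End RightAction.
End Variety.

(* Main.v *)
(* For 0 < i < p, theta_i(x) is the coefficient of T^i in log (sum_k X_k T^k)
   with X_0 = 1: this is the multinomial expansion of the powers in the
   logarithm series.  Since log turns products into sums, theta_i is additive
   for the multiplication of truncated power series, which is how h in J(m)
   acts on row vectors.  Hence replacing z by z h multiplies s z^(i)_0 by
   h_(i,0) and adds theta_j(h_i) to theta_j(s z^(i)); on t and u this is undone
   by an N-th root of h_(i,0) and by an Artin-Schreier root of theta_j(h_i).

   Additivity is proved for logarithms truncated at order i, by comparing
   logarithmic derivatives modulo T^i: (1 + g) (log (1 + g))' = g', and i is
   invertible. *)
Require Import Defs.
From HB Require Import structures.
From mathcomp Require Import all_boot all_order all_algebra.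
From mathcomp Require Import pgroup finfield ring.

Set Implicit Arguments.
Unset Strict Implicit.
Unset Printing Implicit Defensive.

Import GRing.Theory.
Local Open Scope ring_scope.

(** * Multinomial coefficients from truncated exponentials *)

Section TruncatedExponential.
Variables (F : fieldType) (R : comNzRingType) (str : {rmorphism F -> R}).
Variable M : nat.
Hypothesis factM : forall n, (n <= M)%N -> n`!%:R != 0 :> F.

Definition texp (a : R) : {poly R} :=
  \poly_(k < M.+1) (str (k`!%:R^-1) * a ^+ k).

(** [p] is constrained only up to degree [n], because a product of truncated exponentials is an
    exponential only up to degree [M]. *)
Lemma coef_texpM (a b : R) (p : {poly R}) n :
    (n <= M)%N ->
    (forall k, (k <= n)%N -> p`_k = str (k`!%:R^-1) * b ^+ k) ->
  (texp a * p)`_n = str (n`!%:R^-1) * (a + b) ^+ n.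
Proof.
move=> nM pE; rewrite coefM addrC exprDn mulr_sumr; apply: eq_bigr => k _.
have kn : (k <= n)%N by rewrite -ltnS.
rewrite coef_poly ltnS (leq_trans kn nM) pE ?leq_subr //.
rewrite mulrACA [a ^+ k * _]mulrC -[_ *+ 'C(n, k)]mulr_natl !mulrA.
rewrite -(rmorph_nat str) -!(rmorphM str) -!mulrA; congr (str _ * _).
(* Since n! = C(n,k) k! (n-k)! is nonzero in [F], so are the three factors. *)
have := factM nM; rewrite -(bin_fact kn) !natrM !mulf_eq0 !negb_or.
case/and3P; move: 'C(n, k)%:R k`!%:R (n - k)`!%:R => x y w x0 y0 w0.
by field; rewrite x0 y0 w0.
Qed.

Lemma coef_prod_texp (I : Type) (s : seq I) (a : I -> R) n :
  (n <= M)%N ->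
  (\prod_(j <- s) texp (a j))`_n = str (n`!%:R^-1) * (\sum_(j <- s) a j) ^+ n.
Proof.
elim: s n => [|j s IHs] n nM.
  rewrite !big_nil coef1 expr0n; case: n {nM} => [|n]; last by rewrite mulr0.
  by rewrite fact0 invr1 (rmorph1 str) mulr1.
rewrite !big_cons; apply: coef_texpM => // k kn.
exact/IHs/(leq_trans kn).
Qed.

(** Both sides are the coefficient of degree [n] in the product of the [texp (a j)]. The index type
    does not depend on [n], so that all powers in the logarithm are summed over one type. *)
Lemma multinomial (m n : nat) (a : 'I_m -> R) :
  (n <= M)%N ->
  str (n`!%:R^-1) * (\sum_(j < m) a j) ^+ n =
  \sum_(k : {ffun 'I_m -> 'I_M.+1} | (\sum_(j < m) k j == n)%N)
     str ((\prod_(j < m) (k j)`!)%:R^-1) * \prod_(j < m) a j ^+ k j.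
Proof.
move=> nM; rewrite -coef_prod_texp //.
under eq_bigr do rewrite /texp poly_def.
rewrite bigA_distr_bigA coef_sum [RHS]big_mkcond; apply: eq_bigr => k _ /=.
rewrite scaler_prod prodrXr coefZ coefXn eq_sym.
case: eqP => _; last by rewrite mulr0.
by rewrite mulr1 big_split -rmorph_prod prodfV natr_prod.
Qed.

End TruncatedExponential.

(** * Additivity of truncated logarithms *)

Section TruncatedLogarithm.
Variables (F : fieldType) (R : comNzRingType) (str : {rmorphism F -> R}).
Variable i : nat.
Hypothesis natr_neq0 : forall n, (0 < n <= i)%N -> n%:R != 0 :> F.

Definition tlog (g : {poly R}) : {poly R} :=
  \sum_(n < i) (str ((-1) ^+ n / n.+1%:R))%:P * g ^+ n.+1.

(** The derivative of [tlog g] is g' times a geometric sum in [- g], which telescopes against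
    [1 + g]. *)
Lemma deriv_tlog (g : {poly R}) :
  (1 + g) * (tlog g)^`() = g^`() * (1 - (- g) ^+ i).
Proof.
have -> : (tlog g)^`() = g^`() * \sum_(n < i) (- g) ^+ n.
  rewrite /tlog raddf_sum mulr_sumr; apply: eq_bigr => n _ /=.
  rewrite derivM derivC mul0r add0r deriv_exp /= mulrnAr -mulrnAl mulrCA.
  congr (_ * _); rewrite (exprNn g); congr (_ * _).
  rewrite -(rmorphMn polyC) -(rmorphMn str) -[_ / _ *+ _]mulr_natr.
  by rewrite divfK ?natr_neq0 //= !rmorph_sign.
have := subrX1 (- g) i; move: (\sum_(n < i) _) => S E.
have -> : 1 - (- g) ^+ i = (1 + g) * S by rewrite -opprB E; ring.
by ring.
Qed.

Lemma tlogM (a b c r : {poly R}) : (0 < i)%N ->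
    a`_0 = 0 -> b`_0 = 0 -> c`_0 = 0 ->
    1 + c = (1 + a) * (1 + b) + r * 'X^(i.+1) ->
  (tlog c)`_i = (tlog a)`_i + (tlog b)`_i.
Proof.
move=> i_gt0 a0 b0 c0 cE.
have powX (g : {poly R}) : g`_0 = 0 -> exists h, (- g) ^+ i = h * 'X^i.
  move=> g0; exists ((- drop_poly 1 g) ^+ i).
  rewrite -{1}(poly_take_drop 1 g) expr1 -exprMn; congr (_ ^+ i).
  by rewrite (_ : take_poly 1 g = 0) ?add0r ?mulNr // ; apply/polyP => -[|k];
     rewrite coef_take_poly coef0.
have [ha haE] := powX a a0; have [hb hbE] := powX b b0.
have [hc hcE] := powX c c0.
have := deriv_tlog a; have := deriv_tlog b; have := deriv_tlog c.
rewrite haE hbE hcE.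
set A := (tlog a)^`(); set B := (tlog b)^`(); set C := (tlog c)^`() => EC EB EA.
have : (1 + c)^`() = ((1 + a) * (1 + b) + r * 'X^(i.+1))^`() by rewrite cE.
rewrite !(derivD, derivM, derivXn, derivC, derivE) !add0r /= => dE.
(* By the Leibniz rule, c' cancels (1 + b) a' + (1 + a) b'; [u] collects the remaining terms, each
   with ['X^i] taken out. *)
have [u uE] : exists u, (1 + c) * (C - A - B) = u * 'X^i.
  exists (- c^`() * hc + (r^`() * 'X + r *+ i.+1) + (1 + b) * a^`() * ha
          + (1 + a) * b^`() * hb - r * 'X * (A + B)).
  have -> : (1 + c) * (C - A - B) = (1 + c) * C - (1 + b) * ((1 + a) * A)
      - (1 + a) * ((1 + b) * B) - r * 'X^(i.+1) * (A + B).
    by rewrite 2!mulrBr -!addrA; congr (_ + _); rewrite cE; ring.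
  rewrite EA EB EC mulrBr mulr1 {1}dE exprSr.
  move: {dE EC EB EA cE haE hbE hcE powX}('X^i) (i.+1) => Y n.
  by ring.
(* [1 + c] is invertible modulo ['X^i]: the geometric sum [S] satisfies (1 + c) S = 1 - (-c)^i. *)
have [v vE] : exists v, C - A - B = v * 'X^i.
  have := subrX1 (- c) i; move: (\sum_(n < i) _) => S E.
  exists (S * u + hc * (C - A - B)).
  rewrite mulrDl -mulrA -uE mulrAC -hcE.
  have -> : (- c) ^+ i = 1 + (- c - 1) * S by rewrite -E; ring.
  by ring.
have : (C - A - B)`_i.-1 = 0 by rewrite vE coefMXn prednK ?leqnn.
rewrite !coefB !coef_deriv prednK // -!mulrnBl => H.
have iF : i%:R != 0 :> F by rewrite natr_neq0 // i_gt0 leqnn.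
suff : (tlog c)`_i - (tlog a)`_i - (tlog b)`_i = 0.
  by move/eqP; rewrite subr_eq0 subr_eq addrC => /eqP.
rewrite -[LHS]mul1r -(rmorph1 str) -(mulVf iF) rmorphM rmorph_nat -mulrA.
by rewrite mulr_natl H mulr0.
Qed.

End TruncatedLogarithm.

(** * Theta as a coefficient of the logarithm *)

Section Theta.
Variables (F : fieldType) (A : comUnitRingType) (str : {rmorphism F -> A}).
Variable i : nat.
Hypothesis natr_neq0 : forall n, (0 < n <= i)%N -> n%:R != 0 :> F.

Let fact_neq0 n : (n <= i)%N -> n`!%:R != 0 :> F.
Proof.
elim: n => [|n IHn] ni; first exact: oner_neq0.
by rewrite factS natrM mulf_neq0 ?IHn ?natr_neq0 // ltnW.
Qed.

Definition tser (x : nat -> A) : {poly A} :=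
  \sum_(j < i) (x j.+1 / x 0%N) *: 'X^(j.+1).

Lemma theta_tlog (x : nat -> A) : (0 < i)%N ->
  theta str i x = (tlog str i (tser x))`_i.
Proof.
move=> i_gt0; pose wt (k : {ffun 'I_i -> 'I_i.+1}) := (\sum_(j < i) j.+1 * k j)%N.
pose deg (k : {ffun 'I_i -> 'I_i.+1}) := (\sum_(j < i) k j)%N.
pose T k := str ((-1) ^+ (deg k).-1 * (deg k).-1`!%:R
                 / (\prod_(j < i) (k j)`!)%:R)
            * \prod_(j < i) (x j.+1 / x 0%N) ^+ k j.
have powE (n : 'I_i) :
    ((str ((-1) ^+ n / n.+1%:R))%:P * tser x ^+ n.+1)`_i
    = \sum_(k | deg k == n.+1) if wt k == i then T k else 0.
  have := multinomial (polyC \o str) fact_neq0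
            (fun j : 'I_i => (x j.+1 / x 0%N) *: 'X^(j.+1)) (ltn_ord n).
  have n0 : n.+1`!%:R != 0 :> F by apply: fact_neq0.
  (* The factor (-1)^n n! turns the 1/(n+1)! of [multinomial] into the logarithm coefficient
     (-1)^n/(n+1). *)
  move/(congr1 (fun P => ((str ((-1) ^+ n * n`!%:R))%:P * P)`_i)).
  rewrite mulrA -(rmorphM (polyC \o str)) /=.
  rewrite (_ : _ * _ / n.+1`!%:R = (-1) ^+ n / n.+1%:R); last first.
    move: n0; rewrite factS natrM mulf_eq0 negb_or.
    by move: n.+1%:R n`!%:R => u v /andP[u0 v0]; field; rewrite u0 v0.
  move=> ->; rewrite mulr_sumr coef_sum; apply: eq_bigr => k /eqP kn.
  rewrite mulrA -(rmorphM (polyC \o str)) /= coefCM.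
  under [in X in _ * X]eq_bigr do rewrite exprZn -exprM.
  rewrite scaler_prod prodrXr coefZ coefXn eq_sym /T /deg kn /=.
  by case: eqP => _; rewrite ?mulr1 ?mulr0.
rewrite /tlog coef_sum (eq_bigr _ (fun n _ => powE n)) /theta.
rewrite [LHS](_ : _ = \sum_(k | wt k == i) \sum_(n < i | deg k == n.+1) T k).
  rewrite (exchange_big_dep xpredT) //=; apply: eq_bigr => n _.
  by rewrite [LHS]big_mkcondl.
apply: eq_bigr => k /eqP wk.
(* Weight [i > 0] forces 1 <= deg k <= i, so exactly one [n] in the inner sum selects [k]. *)
have deg_gt0 : (0 < deg k)%N.
  rewrite lt0n; apply: contraTneq i_gt0 => deg0; rewrite -leqNgt -wk.
  have /leq_trans -> // : (wt k <= i * deg k)%N by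
    rewrite big_distrr leq_sum // => j _; rewrite leq_mul2r ltn_ord orbT.
  by rewrite deg0 muln0.
have deg_lt : ((deg k).-1 < i)%N.
  rewrite prednK // -[leqRHS]wk leq_sum // => j _.
  exact: leq_pmull.
rewrite [RHS](big_pred1 (Ordinal deg_lt)) // => n.
by rewrite /= -val_eqE /= -[in LHS](prednK deg_gt0) eqSS eq_sym.
Qed.

Lemma coef_tser (x : nat -> A) k : x 0%N \is a GRing.unit -> (k <= i)%N ->
  (1 + tser x)`_k = x k / x 0%N.
Proof.
move=> x0 ki; rewrite coefD coef1 coef_sum.
case: k ki => [|k] ki; last first.
  rewrite add0r (bigD1 (Ordinal ki)) //= coefZ coefXn eqxx mulr1 big1 ?addr0 //.
  by move=> j /eqP jk; rewrite coefZ coefXn eqSS; case: eqP => [E|];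
     [case: jk; apply: val_inj | rewrite mulr0].
by rewrite divrr // big1 ?addr0 // => j _; rewrite coefZ coefXn mulr0.
Qed.

Lemma theta_conv (x y w : nat -> A) : (0 < i)%N ->
    x 0%N \is a GRing.unit -> y 0%N \is a GRing.unit ->
    (forall k, (k <= i)%N -> w k = \sum_(a < k.+1) x a * y (k - a)%N) ->
  theta str i w = theta str i x + theta str i y.
Proof.
move=> i_gt0 x0 y0 wE; rewrite !theta_tlog //.
have w0E : w 0%N = x 0%N * y 0%N by rewrite wE // big_ord1.
have w0 : w 0%N \is a GRing.unit by rewrite w0E unitrM x0.
have tser0 u : (tser u)`_0 = 0.
  by rewrite coef_sum big1 // => j _; rewrite coefZ coefXn mulr0.
(* [D] vanishes up to degree [i]; its quotient by ['X^(i.+1)] is the remainder [r] allowed in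
   [tlogM]. *)
pose D := 1 + tser w - (1 + tser x) * (1 + tser y).
apply: (@tlogM _ _ _ _ _ _ _ _ (drop_poly i.+1 D)) => //.
rewrite -[LHS](subrK ((1 + tser x) * (1 + tser y))) addrC; congr (_ + _).
rewrite -/D -[LHS](poly_take_drop i.+1) (_ : take_poly _ _ = 0) ?add0r //.
apply/polyP => k; rewrite coef_take_poly coef0; case: ltnP => //.
rewrite ltnS => ki.
rewrite coefB coef_tser // coefM wE // mulr_suml; apply/eqP; rewrite subr_eq0.
apply/eqP/eq_bigr => a _; have ak : (a <= k)%N by rewrite -ltnS.
rewrite !coef_tser ?(leq_trans _ ki) ?leq_subr //.
by rewrite w0E invrM // [(y 0%N)^-1 * _]mulrC mulrACA.
Qed.

End Theta.

(** Follows from [thetabar_rmorph] by cancelling the unit [y 0 ^+ i]. *)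
Lemma theta_rmorph (F : fieldType) (A B : comUnitRingType)
    (sA : {rmorphism F -> A}) (sB : {rmorphism F -> B})
    (f : {rmorphism A -> B}) (i : nat) (x : nat -> A) (y : nat -> B) :
  (forall c, f (sA c) = sB c) -> x 0%N \is a GRing.unit ->
  (forall k, y k = f (x k)) ->
  theta sB i y = f (theta sA i x).
Proof.
move=> fs x0 yE; have y0 : y 0%N \is a GRing.unit by rewrite yE rmorph_unit.
apply: (mulrI (unitrX i y0)); have := thetabar_rmorph i fs x0 yE.
by rewrite /thetabar rmorphM rmorphXn -yE.
Qed.

(** * Bracket matrices act on row vectors by truncated convolution *)

Lemma rseq_ord (A : nmodType) m (v : 'rV[A]_m) (i : 'I_m) : rseq v i = v 0 i.
Proof. by rewrite /rseq valK. Qed.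

Lemma shift_mxX (F : fieldType) m n (a b : 'I_m) :
  (shift_mx F m ^+ n) a b = (b == a + n :> nat)%N%:R.
Proof.
elim: n a => [|n IHn] a; first by rewrite expr0 mxE addn0 eq_sym.
rewrite exprS mxE addnS; have [am|ma] := ltnP a.+1 m; last first.
  rewrite big1 ?(ltn_eqF _) //.
    by rewrite (leq_trans (ltn_ord b)) // (leq_trans ma) // ltnS leq_addr.
  by move=> j _; rewrite mxE ltn_eqF ?mul0r // (leq_trans (ltn_ord j)).
rewrite (bigD1 (Ordinal am)) //= mxE eqxx mul1r IHn addSn big1 ?addr0 // => j.
by rewrite mxE -val_eqE /= => /negPf ->; rewrite mul0r.
Qed.

Lemma bracketE (F : fieldType) m (c : 'rV[F]_m) (a b : 'I_m) :
  bracket c a b = if (a <= b)%N then rseq c (b - a) else 0.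
Proof.
rewrite /bracket summxE; case: leqP => [ab|ba].
  have bam : (b - a < m)%N by rewrite (leq_ltn_trans (leq_subr _ _)).
  rewrite (bigD1 (Ordinal bam)) //= mxE shift_mxX /= subnKC // eqxx mulr1.
  rewrite -rseq_ord /= big1 ?addr0 // => j; rewrite -val_eqE /= => ne.
  rewrite mxE shift_mxX (_ : _ == _ = false) ?mulr0 //.
  by apply: contraNF ne => /eqP ->; rewrite addKn.
rewrite big1 // => j _; rewrite mxE shift_mxX ltn_eqF ?mulr0 //.
by rewrite (leq_trans ba) ?leq_addr.
Qed.

Lemma rseq_mul_bracket (F : fieldType) (A : comUnitRingType)
    (str : {rmorphism F -> A}) m (v : 'rV[A]_m) (c : 'rV[F]_m) k :
  (k < m)%N ->
  rseq (v *m map_mx str (bracket c)) k =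
  \sum_(a < k.+1) rseq v a * str (rseq c (k - a)).
Proof.
move=> km; rewrite (rseq_ord _ (Ordinal km)) mxE.
rewrite (big_ord_widen m (fun a => rseq v a * str (rseq c (k - a)))) //.
rewrite [RHS]big_mkcond; apply: eq_bigr => j _; rewrite mxE bracketE /= ltnS.
by rewrite -rseq_ord; case: leqP => // _; rewrite rmorph0 mulr0.
Qed.

(** [Jgroup] only supplies some coefficients with the same bracket; the top left entry shows that
    both choices agree at index 0. *)
Lemma Jgroup_bracket (F : fieldType) m (c : 'rV[F]_m) :
  (0 < m)%N -> Jgroup (bracket c) -> rseq c 0 != 0.
Proof.
case: m c => // m c _ [c' c'0 /(congr1 (fun M : 'M_m.+1 => M ord0 ord0))].
by rewrite !bracketE /= => ->.
Qed.

(** [str] transfers the characteristic of [F] to [A], and [#|F|] is a power of it. *)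
Lemma exprD_card (F : finFieldType) (A : comNzRingType)
    (str : {rmorphism F -> A}) (x y : A) :
  (x + y) ^+ #|F| = x ^+ #|F| + y ^+ #|F|.
Proof.
have [p _ pF] := finPcharP F; apply: exprDn_pchar.
have pA : p \in [pchar A] by rewrite (rmorph_pchar str).
rewrite (eq_pnat _ (pcharf_eq pA)).
by have := pprimeChar_pgroup pF; rewrite /pgroup cardsT.
Qed.

(** * Left and right translations on points *)

Section Points.
Variables (F : finFieldType) (l : nat) (Delta : 'I_l -> nat) (d : nat).
Implicit Types (z : 'M[F]_(d, \sum_i Delta i)) (A : kalgebra F).

(** The equations involve [s] and [z] only through the product [s z]. *)
Lemma Xpt_sz z z' A (x y : Defs.coord Delta d -> A) :
    (forall i, x (Ct i) = y (Ct i)) ->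
    (forall i j, x (Cu i j) = y (Cu i j)) ->
    srow x *m map_mx (kalg_str A) z = srow y *m map_mx (kalg_str A) z' ->
  Xpt z x -> Xpt z' y.
Proof.
move=> tE uE szE Xx i; have [tU t0 tu] := Xx i.
have E : sz z' y i = sz z x i.
  rewrite /sz; congr (rseq _); have := congr1 (fun w => submxrow w i) szE.
  have mapE (w : 'M[F]_(d, \sum_i Delta i)) :
      map_mx (kalg_str A) (submxrow w i) = submxrow (map_mx (kalg_str A) w) i.
    by apply/matrixP => a b; rewrite !mxE.
  by rewrite /= -!mul_submxrow -!mapE => ->.
by split; rewrite -?tE ?E // => j; rewrite -uE tu.
Qed.

Lemma srow_Lmap g A (x : Defs.coord Delta d -> A) :
  srow (Lmap g x) = srow x *m map_mx (kalg_str A) (invmx g).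
Proof. by apply/rowP => a; rewrite mxE. Qed.

Lemma Xpt_Lmap z g A (x : Defs.coord Delta d -> A) : g \in unitmx ->
  Xpt z x -> Xpt (g *m z) (Lmap g x).
Proof.
move=> gU; apply: Xpt_sz => //.
by rewrite srow_Lmap -mulmxA -map_mxM mulmxA mulVmx // mul1mx.
Qed.

Lemma LmapK g A (x : Defs.coord Delta d -> A) : g \in unitmx ->
  Lmap (invmx g) (Lmap g x) =1 x.
Proof.
move=> gU [i|i j|a] //=; rewrite srow_Lmap -mulmxA -map_mxM invmxK mulVmx //.
by rewrite map_mx1 mulmx1 mxE.
Qed.

Lemma Lmap_hom g (A B : kalgebra F) (f : khom A B) (x : Defs.coord Delta d -> A) :
  Lmap g (fun v => f (x v)) =1 (fun w => f (Lmap g x w)).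
Proof.
case=> [i|i j|a] //=; rewrite !mxE rmorph_sum; apply: eq_bigr => b _.
by rewrite !mxE rmorphM khomP.
Qed.

(* The right translation, over any F-algebra with N-th roots [rho i] of the
   h_(i,0) and solutions [e i j] of the Artin-Schreier equations. *)
Lemma Xpt_twist z A (c : forall i, 'rV[F]_(Delta i)) (rho : 'I_l -> A)
    (e : forall i, 'I_(Delta i).-1 -> A) (x y : Defs.coord Delta d -> A) :
    (forall i, 0 < Delta i)%N ->
    (forall i n, (0 < n < Delta i)%N -> n%:R != 0 :> F) ->
    (forall i, rseq (c i) 0 != 0) ->
    (forall i, rho i ^+ #|F|.-1 = kalg_str A (rseq (c i) 0)) ->
    (forall i j, e i j ^+ #|F| - e i j =
       kalg_str A (theta idfun j.+1 (rseq (c i)))) ->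
    (forall i, y (Ct i) = rho i * x (Ct i)) ->
    (forall i j, y (Cu i j) = x (Cu i j) + e i j) ->
    (forall a, y (Cs a) = x (Cs a)) ->
  Xpt z x <-> Xpt (z *m \mxdiag_(i < l) bracket (c i)) y.
Proof.
move=> D0 Dn c0 rhoE eE yt yu ys; set zh := z *m _.
have N_gt0 : (0 < #|F|.-1)%N by rewrite -subn1 subn_gt0 finNzRing_gt1.
have c0U i : kalg_str A (rseq (c i) 0) \is a GRing.unit.
  by rewrite rmorph_unit ?unitfE.
have rhoU i : rho i \is a GRing.unit by rewrite -(unitrX_pos _ N_gt0) rhoE.
have szE i k : (k < Delta i)%N ->
    sz zh y i k = \sum_(a < k.+1) sz z x i a * kalg_str A (rseq (c i) (k - a)).
  move=> kD; rewrite /sz -rseq_mul_bracket // -mulmxA -map_mxM /zh.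
  rewrite -{1}[z]submxrowK mul_mxrow_mxdiag mxrowK.
  by congr (rseq (_ *m _) k); apply/rowP => a; rewrite !mxE.
have sz0 i : sz zh y i 0 = kalg_str A (rseq (c i) 0) * sz z x i 0.
  by rewrite szE // big_ord1 mulrC.
(* The coefficients of h_i are moved into [A] by [theta_rmorph], then [theta_conv] applies since j +
   1 < N_i. *)
have thE i (j : 'I_(Delta i).-1) : sz z x i 0 \is a GRing.unit ->
    theta (kalg_str A) j.+1 (sz zh y i) =
    theta (kalg_str A) j.+1 (sz z x i)
    + kalg_str A (theta idfun j.+1 (rseq (c i))).
  move=> sU; have jD : (j.+1 < Delta i)%N by rewrite -ltn_predRL.
  rewrite -(@theta_rmorph _ _ _ idfun (kalg_str A) (kalg_str A) _ _
     (fun k => kalg_str A (rseq (c i) k))) ?unitfE //.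
  apply: theta_conv => // [n /andP[n0 nj]|k kj]; last first.
    by apply: szE; apply: leq_ltn_trans jD.
  by apply: (Dn i); rewrite n0 (leq_ltn_trans nj).
(* The defect of the equation at [y] is the defect at [x] times a power of the unit h_(i,0), which
   gives both implications. *)
have stepE i (j : 'I_(Delta i).-1) :
    x (Ct i) \is a GRing.unit -> x (Ct i) ^+ #|F|.-1 = sz z x i 0 ->
    y (Ct i) ^+ (#|F|.-1 * j.+1) * (y (Cu i j) ^+ #|F| - y (Cu i j))
    - thetabar (kalg_str A) j.+1 (sz zh y i)
    = kalg_str A (rseq (c i) 0) ^+ j.+1 *
      (x (Ct i) ^+ (#|F|.-1 * j.+1) * (x (Cu i j) ^+ #|F| - x (Cu i j))
       - thetabar (kalg_str A) j.+1 (sz z x i)).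
  move=> tU t0; have sU : sz z x i 0 \is a GRing.unit by rewrite -t0 unitrX.
  rewrite /thetabar thE // sz0 -eE yu (exprD_card (kalg_str A)) yt !exprM.
  rewrite exprMn rhoE t0 exprMn.
  by move: (_ ^+ j.+1) (_ ^+ j.+1) (_ ^+ #|F|) (_ ^+ #|F|) => P Q ? ?; ring.
split=> X i; have [tU t0 tu] := X i.
  split; first by rewrite yt unitrM rhoU.
    by rewrite sz0 -t0 yt exprMn rhoE.
  by move=> j; apply/eqP; rewrite -subr_eq0 stepE // tu subrr mulr0.
have txU : x (Ct i) \is a GRing.unit by move: tU; rewrite yt unitrM rhoU.
have tx0 : x (Ct i) ^+ #|F|.-1 = sz z x i 0.
  by apply: (mulrI (c0U i)); rewrite -sz0 -t0 yt exprMn rhoE.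
split=> // j; apply/eqP; rewrite -subr_eq0; apply/eqP.
by apply: (mulrI (unitrX j.+1 (c0U i))); rewrite -stepE // tu subrr mulr0.
Qed.

End Points.

Theorem theorem5p1 (F : finFieldType) (p : nat) (hp : p \in [pchar F])
    (l : nat) (Delta : 'I_l -> nat)
    (Delta_gt0 : forall i : 'I_l, (0 < Delta i)%N)
    (Delta_mono : forall i j : 'I_l, (i <= j)%N -> (Delta i <= Delta j)%N)
    (Delta_le_p : forall i : 'I_l, (Delta i <= p)%N)
    (d : nat) (z : 'M[F]_(d, \sum_(i < l) Delta i)) :
  (forall g : 'M[F]_d, g \in unitmx ->
     is_isomorphism (Xvar z) (Xvar (g *m z)) (Lmap g)) /\
  (forall (K : finFieldType) (iota : {rmorphism F -> K})
     (root : F -> K) (r1 : K) (c : forall i : 'I_l, 'rV[F]_(Delta i)),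
     #|K| = (if [forall i, Delta i == 1%N] then #|F| ^ #|F|.-1
             else #|F| ^ (p * #|F|.-1))%N ->
     Nth_root_choice iota root ->
     (* if Delta = (1, .., 1) there are no coordinates u and r1 is not used *)
     (~~ [forall i, Delta i == 1%N] -> AS_root F p r1) ->
     (forall i, Jgroup (bracket (c i))) ->
     is_isomorphism (base_change iota (Xvar z))
       (base_change iota (Xvar (z *m \mxdiag_(i < l) bracket (c i))))
       (Rmap iota root r1 c)).
Proof.
split=> [g gU|K iota root r1 c _ [_ rootP] r1P cJ].
  have gVU : invmx g \in unitmx by rewrite unitmx_inv.
  split; first by split=> [A x|A B f x _]; [exact: Xpt_Lmap | exact: Lmap_hom].
  exists (Lmap (invmx g)); split=> [|A x _|A y _]; last 2 first.
  - exact: LmapK.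
  - by have := LmapK y gVU; rewrite invmxK.
  split=> [A y /(Xpt_Lmap gVU)|A B f y _]; last exact: Lmap_hom.
  by rewrite mulmxA mulVmx // mul1mx.
have c0 i : rseq (c i) 0 != 0 by apply: Jgroup_bracket.
have N_gt0 : (0 < #|F|.-1)%N by rewrite -subn1 subn_gt0 finNzRing_gt1.
have root_neq0 i : root (rseq (c i) 0) != 0.
  have := c0 i; rewrite -(fmorph_eq0 iota); have [<- _] := rootP _ (c0 i).
  by rewrite expf_eq0 N_gt0.
(* With [y] known only pointwise, the equivalence also applies to [S A y], whose image under [Rmap]
   is only pointwise equal to [y]. *)
have RmapP (A : kalgebra K) (x y : Defs.coord Delta d -> A) :
    Rmap iota root r1 c x =1 y ->
    base_change iota (Xvar z) A x <->
    base_change iota (Xvar (z *m \mxdiag_(i < l) bracket (c i))) A y.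
  move=> xy.
  apply: (@Xpt_twist _ _ _ _ z (restrict iota A) c
     (fun i => kalg_str A (root (rseq (c i) 0)))
     (fun i j => kalg_str A (iota (theta idfun j.+1 (rseq (c i))) * r1))).
  - exact: Delta_gt0.
  - move=> i n /andP[n_gt0 nD]; rewrite -(dvdn_pcharf hp) gtnNdvd //.
    exact: leq_trans nD (Delta_le_p i).
  - exact: c0.
  - by move=> i; rewrite -rmorphXn; have [-> _] := rootP _ (c0 i).
  (* The existence of [j] excludes N_i = 1, so [r1] is an Artin-Schreier root; its multiple by an
     element of [F], fixed by the q-power map, solves the scaled equation. *)
  - move=> i j; have [|r1E _] := r1P.
      apply/forallPn; exists i; apply/eqP => D1.
      by case: j => j /=; rewrite D1.
    rewrite -rmorphXn -rmorphB exprMn -rmorphXn expf_card -mulrBr.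
    by rewrite r1E mulr1.
  - by move=> i; rewrite -xy.
  - by move=> i j; rewrite -xy.
  - by move=> a; rewrite -xy.
(* The inverse is written coordinatewise: the chosen N-th roots need not be multiplicative, so the
   map [Rmap] of the inverse of h could differ from it. *)
pose S (A : kalgebra K) (y : Defs.coord Delta d -> A) (v : Defs.coord Delta d) : A :=
  match v with
  | Ct i => kalg_str A (root (rseq (c i) 0))^-1 * y (Ct i)
  | Cu i j => y (Cu i j)
              - kalg_str A (iota (theta idfun j.+1 (rseq (c i))) * r1)
  | Cs a => y (Cs a)
  end.
have RS (A : kalgebra K) (y : Defs.coord Delta d -> A) :
    Rmap iota root r1 c (S A y) =1 y.
  case=> [i|i j|a] //=; last by rewrite subrK.
  by rewrite mulrA -rmorphM divff // rmorph1 mul1r.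
split.
  split=> [A x /RmapP|A B f x _]; first exact.
  by case=> [i|i j|a] //=; rewrite ?(rmorphM f) ?(rmorphD f) khomP.
exists S; split=> [|A x _|A y _]; last 2 first.
- case=> [i|i j|a] //=; last by rewrite addrK.
  by rewrite mulrA -rmorphM mulVf // rmorph1 mul1r.
- exact: RS.
split=> [A y|A B f x _]; first by move/(RmapP _ _ _ (RS A y)).
by case=> [i|i j|a] //=; rewrite ?(rmorphM f) ?(rmorphB f) khomP.
Qed.
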